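(* Let $F_2 = \langle x, y \rangle$ be the free group of rank $2$ on $x,y$, let $\theta$ be the automorphism of $F_2$ with $\theta(x) = x^{-1}$, $\theta(y) = y^{-1}$, and let $H_0 \leq F_2$ be the kernel of the homomorphism $F_2 \to \mathbb{Z}_2 = \langle \theta \rangle$ given by $x \mapsto \theta$, $y \mapsto \theta$. Define an operation $\circ$ on $F_2$ by $$a \circ b = \begin{cases} ab, & \text{if } a \in H_0,\ b \in F_2,\\ a\,\theta(b), & \text{if } a \notin H_0,\ b \in F_2.\end{cases}$$ Then $(F_2, \cdot, \circ)$ is a skew left brace. Moreover, the group $(F_2, \circ)$ is presented by $$F_3 \rtimes \mathbb{Z}_2 = \langle p, q, r, s \mid s^2 = 1,\ sps = p^{-1},\ sqs = q^{-1},\ srs = p r^{-1} p^{-1} \rangle ,$$ where $F_3$ is the free group on $p,q,r$ and $\mathbb{Z}_2 = \langle s \rangle$.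
   Context: A skew left brace is a triple $(G, \cdot, \circ)$ where $(G,\cdot)$ and $(G,\circ)$ are groups and $g_1 \circ (g_2 \cdot g_3) = (g_1 \circ g_2)\cdot g_1^{-1} \cdot (g_1 \circ g_3)$ for all $g_1,g_2,g_3 \in G$, where $g_1^{-1}$ is the inverse in $(G,\cdot)$. Here $\cdot$ is the usual multiplication of $F_2$. *)

(* Defs.v *)
From HB Require Import structures.
From mathcomp Require Import all_boot all_fingroup zmodp.

Set Implicit Arguments.
Unset Strict Implicit.
Unset Printing Implicit Defensive.

Local Open Scope group_scope.

(* Free groups, realized by reduced words.  The letter (i, false) stands for  *)
(* the generator i and (i, true) for its inverse.                             *)
Section ReducedWords.
Variable I : choiceType.
Local Notation letter := (I * bool)%type.
Implicit Types (l m : letter) (s t u : seq letter).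

Definition invl l : letter := (l.1, ~~ l.2).

Definition reduced s := sorted (fun l m => m != invl l) s.

Definition consl l s :=
  if s is m :: t then if m == invl l then t else l :: s else [:: l].

Definition mulw s t := foldr consl t s.
Definition invw s := rev (map invl s).

Lemma invlK : involutive invl.
Proof. by case=> i b; rewrite /invl /= negbK. Qed.

Lemma reduced_tail l s : reduced (l :: s) -> reduced s.
Proof. by case: s => //= m t /andP[]. Qed.

Lemma reduced_consl l s : reduced s -> reduced (consl l s).
Proof.
case: s => [|m t] //= mt; case: ifP => [_|/negbT lm]; first exact: reduced_tail mt.
by rewrite /reduced /= lm.
Qed.

Lemma reduced_mulw s t : reduced t -> reduced (mulw s t).
Proof. by move=> rt; elim: s => //= l s; apply: reduced_consl. Qed.

Lemma consl_reduced l s : reduced (l :: s) -> consl l s = l :: s.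
Proof. by case: s => //= m t /andP[/negbTE ->]. Qed.

Lemma conslK l s : reduced s -> consl l (consl (invl l) s) = s.
Proof.
case: s => [|m t] /=; first by rewrite eqxx.
rewrite invlK; case: eqP => [-> lt|_ _ /=]; first exact: consl_reduced.
by rewrite eqxx.
Qed.

Lemma mulw_consl l s t : reduced t -> mulw (consl l s) t = consl l (mulw s t).
Proof.
case: s => [|m u] //= rt; case: eqP => [->|_] //=.
by rewrite conslK //; apply: reduced_mulw.
Qed.

Lemma mulwA s t u : reduced u -> mulw s (mulw t u) = mulw (mulw s t) u.
Proof. by move=> ru; elim: s => //= l s ->; rewrite mulw_consl. Qed.

Lemma mulws1 s : reduced s -> mulw s [::] = s.
Proof.
by elim: s => //= l s IH ls; rewrite IH ?consl_reduced //; apply: reduced_tail ls.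
Qed.

Lemma reduced_invw s : reduced s -> reduced (invw s).
Proof.
rewrite /reduced /invw rev_sorted sorted_map; apply: sub_sorted => l m /=.
by rewrite invlK eq_sym -(inj_eq (can_inj invlK)) invlK.
Qed.

Lemma invwK : involutive invw.
Proof. by move=> s; rewrite /invw map_rev revK mapK //; apply: invlK. Qed.

Lemma mulVw s : mulw (invw s) s = [::].
Proof.
elim: s => //= l s IH; rewrite /mulw /invw /= rev_cons foldr_rcons /=.
by rewrite invlK eqxx.
Qed.

End ReducedWords.

Record freegroup (I : choiceType) : Type :=
  FreeGroup { word :> seq (I * bool); _ : reduced word }.

HB.instance Definition _ (I : choiceType) := [isSub for @word I].
HB.instance Definition _ (I : choiceType) := [Choice of freegroup I by <:].

Section FreeGroup.
Variable I : choiceType.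
Implicit Types u v w : freegroup I.

Lemma wordP u : reduced u. Proof. exact: (valP u). Qed.

Definition fg_one : freegroup I := @FreeGroup I [::] isT.
Definition fg_mul u v : freegroup I := FreeGroup (reduced_mulw u (wordP v)).
Definition fg_inv u : freegroup I := FreeGroup (reduced_invw (wordP u)).

Fact fg_mulA : associative fg_mul.
Proof. by move=> u v w; apply/val_inj/mulwA/wordP. Qed.
Fact fg_mul1 : left_id fg_one fg_mul.
Proof. by move=> u; apply/val_inj. Qed.
Fact fg_mulr1 : right_id fg_one fg_mul.
Proof. by move=> u; apply/val_inj/mulws1/wordP. Qed.
Fact fg_mulV : left_inverse fg_one fg_inv fg_mul.
Proof. by move=> u; apply/val_inj/mulVw. Qed.
Fact fg_mulrV : right_inverse fg_one fg_inv fg_mul.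
Proof. by move=> u; apply/val_inj; rewrite /= -{1}[val u]invwK mulVw. Qed.

HB.instance Definition _ := isGroup.Build (freegroup I)
  fg_mulA fg_mul1 fg_mulr1 fg_mulV fg_mulrV.

Definition gen (i : I) : freegroup I := @FreeGroup I [:: (i, false)] isT.

End FreeGroup.

(* The homomorphism out of the free group extending f.                        *)
Section Lift.
Variables (I : choiceType) (G : groupType) (f : I -> G).

Definition lift_letter (l : I * bool) : G := if l.2 then (f l.1)^-1 else f l.1.

Definition fg_lift (w : freegroup I) : G := \prod_(l <- word w) lift_letter l.

Lemma lift_consl l s : \prod_(m <- consl l s) lift_letter m =
  lift_letter l * \prod_(m <- s) lift_letter m.
Proof.
have liftV m : lift_letter m * lift_letter (invl m) = 1.
  by case: m => i [] /=; rewrite /lift_letter /= ?mulVg ?mulgV.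
case: s => [|m t] /=; first by rewrite big_cons.
case: eqP => [->|_]; last by rewrite big_cons.
by rewrite big_cons mulgA liftV mul1g.
Qed.

Lemma liftM : {morph fg_lift : u v / u * v}.
Proof.
move=> u v; rewrite /fg_lift /=; elim: (word u) => [|l s IH] /=.
  by rewrite big_nil mul1g.
by rewrite lift_consl IH big_cons mulgA.
Qed.

Lemma lift1 : fg_lift 1 = 1. Proof. exact: big_nil. Qed.

HB.instance Definition _ := isUMagmaMorphism.Build (freegroup I) G fg_lift
  (lift1, liftM).

Lemma lift_gen i : fg_lift (gen i) = f i.
Proof. by rewrite /fg_lift /= big_cons big_nil mulg1. Qed.

Lemma lift_unique (h : freegroup I -> G) :
  {morph h : u v / u * v} -> (forall i, h (gen i) = f i) -> h =1 fg_lift.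
Proof.
move=> hM hg; have h1 : h 1 = 1 by apply: (mulgI (h 1)); rewrite -hM !mulg1.
have hV u : h u^-1 = (h u)^-1.
  by apply: (mulgI (h u)); rewrite -hM !mulgV.
case=> s; elim: s => [|[i b] s IH] rs.
  by rewrite /fg_lift big_nil -h1; congr h; apply/val_inj.
have rt := reduced_tail rs.
have -> : FreeGroup rs = (if b then (gen i)^-1 else gen i) * FreeGroup rt.
  by apply/val_inj; case: b rs => /= rs; rewrite -/(consl _ _) consl_reduced.
rewrite hM liftM IH; congr (_ * _).
by case: (b); rewrite ?hV ?gmulfV /= hg lift_gen.
Qed.

End Lift.

Lemma freegroup_endo_id (I : choiceType) (h : freegroup I -> freegroup I) :
  {morph h : u v / u * v} -> (forall i, h (gen i) = gen i) -> h =1 id.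
Proof.
move=> hM hg u; rewrite (lift_unique hM hg) -[RHS]/(idfun u).
by symmetry; apply: lift_unique.
Qed.

(* R is read as a set of relators: its normal closure is the smallest normal  *)
(* subgroup containing it.                                                    *)
Inductive normal_closure (G : groupType) (R : G -> Prop) : G -> Prop :=
| NC_in g of R g : normal_closure R g
| NC_1 : normal_closure R 1
| NC_M g h of normal_closure R g & normal_closure R h : normal_closure R (g * h)
| NC_V g of normal_closure R g : normal_closure R g^-1
| NC_J g h of normal_closure R g : normal_closure R (g ^ h).

(* A relation u = v is encoded by the pair (u, v).                            *)
Definition relator_of (I : choiceType)
    (rels : seq (freegroup I * freegroup I)) (w : freegroup I) : Prop :=
  exists2 uv, uv \in rels & w = uv.1 * uv.2^-1.

(* G = < I | rels >, where the generator i names the element g i of G: the    *)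
(* homomorphism freegroup I -> G extending g is onto, and its kernel is the   *)
(* normal closure of the relators.                                            *)
Definition presentation_on (G : groupType) (I : choiceType) (g : I -> G)
    (rels : seq (freegroup I * freegroup I)) : Prop :=
  (forall x : G, exists w, fg_lift g w = x) /\
  (forall w, fg_lift g w = 1 <-> normal_closure (relator_of rels) w).

Definition presented_by (G : groupType) (I : choiceType)
    (rels : seq (freegroup I * freegroup I)) : Prop :=
  exists g : I -> G, presentation_on g rels.

Definition isomorphic_groups (G H : groupType) : Prop :=
  exists2 f : G -> H, {morph f : x y / x * y} & bijective f.

Record autAction (H K : groupType) : Type := AutAction {
  aact :> H -> K -> K;
  aact1 : forall k, aact 1 k = k;
  aactA : forall h1 h2 k, aact (h1 * h2) k = aact h1 (aact h2 k);
  aactM : forall h, {morph aact h : k l / k * l}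
}.

(* K ><| H, with (1, h) * (k, 1) * (1, h)^-1 = (a h k, 1).                    *)
Definition semidirect (H K : groupType) (a : autAction H K) : Type :=
  (K * H)%type.

Section Semidirect.
Variables (H K : groupType) (a : autAction H K).

HB.instance Definition _ := Choice.copy (semidirect a) (K * H)%type.

Implicit Types x y : semidirect a.

Definition sd_one : semidirect a := (1, 1).
Definition sd_mul x y : semidirect a := (x.1 * a x.2 y.1, x.2 * y.2).
Definition sd_inv x : semidirect a := (a x.2^-1 x.1^-1, x.2^-1).

Lemma aactg1 h : a h 1 = 1.
Proof. by apply: (mulgI (a h 1)); rewrite -aactM !mulg1. Qed.

Fact sd_mulA : associative sd_mul.
Proof.
by move=> [k1 h1] [k2 h2] [k3 h3]; rewrite /sd_mul /= aactM aactA !mulgA.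
Qed.
Fact sd_mul1 : left_id sd_one sd_mul.
Proof. by case=> k h; rewrite /sd_mul /= aact1 !mul1g. Qed.
Fact sd_mulr1 : right_id sd_one sd_mul.
Proof. by case=> k h; rewrite /sd_mul /= aactg1 !mulg1. Qed.
Fact sd_mulV : left_inverse sd_one sd_inv sd_mul.
Proof. by case=> k h; rewrite /sd_mul /= -aactM !mulVg aactg1. Qed.
Fact sd_mulrV : right_inverse sd_one sd_inv sd_mul.
Proof. by case=> k h; rewrite /sd_mul /= -aactA !mulgV aact1 mulgV. Qed.

HB.instance Definition _ := isGroup.Build (semidirect a)
  sd_mulA sd_mul1 sd_mulr1 sd_mulV sd_mulrV.

End Semidirect.

(* As a groupType, 'Z_2 carries addition mod 2 as its group law, so 1%g is    *)
(* the residue 0 and Zp1 is the nontrivial element.                           *)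
Section InvolutionAction.
Variables (K : groupType) (sigma : K -> K).
Hypothesis sigmaM : {morph sigma : k l / k * l}.
Hypothesis sigmaK : involutive sigma.

Definition invol_act (h : 'Z_2) (k : K) : K := if h == 1 then k else sigma k.

Fact invol_act1 k : invol_act 1 k = k. Proof. by rewrite /invol_act eqxx. Qed.
Fact invol_actA h1 h2 k :
  invol_act (h1 * h2) k = invol_act h1 (invol_act h2 k).
Proof.
by rewrite /invol_act; case: h1 => [[|[|?]] //= ?]; case: h2 => [[|[|?]] //= ?].
Qed.
Fact invol_actM h : {morph invol_act h : k l / k * l}.
Proof. by move=> k l; rewrite /invol_act; case: ifP => // _; exact: sigmaM. Qed.

Definition invol_action : autAction ('Z_2 : groupType) K :=
  AutAction invol_act1 invol_actA invol_actM.

End InvolutionAction.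

(* The skew left brace structures with additive group G and circle operation  *)
(* circ; the unit and inverses of circ are uniquely determined by it.         *)
Record skew_left_brace (G : groupType) (circ : G -> G -> G) : Type :=
  SkewLeftBrace {
    circ_one : G;
    circ_inv : G -> G;
    circA : associative circ;
    circ1g : left_id circ_one circ;
    circg1 : right_id circ_one circ;
    circVg : left_inverse circ_one circ_inv circ;
    circgV : right_inverse circ_one circ_inv circ;
    circ_brace : forall g1 g2 g3 : G,
      circ g1 (g2 * g3) = circ g1 g2 * g1^-1 * circ g1 g3
  }.

Definition circ_group (G : groupType) (circ : G -> G -> G)
  (B : skew_left_brace circ) : Type := G.

HB.instance Definition _ (G : groupType) (circ : G -> G -> G)
  (B : skew_left_brace circ) := Choice.copy (circ_group B) G.
HB.instance Definition _ (G : groupType) (circ : G -> G -> G)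
  (B : skew_left_brace circ) := isGroup.Build (circ_group B)
    (circA B) (circ1g B) (circg1 B) (circVg B) (circgV B).

Notation F2 := (freegroup 'I_2).
Notation F3 := (freegroup 'I_3).
Notation F4 := (freegroup 'I_4).

Section Circ.
Local Notation x := (gen (@Ordinal 2 0 isT)).
Local Notation y := (gen (@Ordinal 2 1 isT)).

Definition theta : F2 -> F2 := fg_lift (tnth [tuple x^-1; y^-1]).

Lemma theta_aut : {morph theta : a b / a * b} /\ involutive theta.
Proof.
split=> [|a]; first exact: liftM.
have tM : {morph theta \o theta : a b / a * b}.
  by move=> b c; rewrite /= /theta !liftM.
have tV u : theta u^-1 = (theta u)^-1 by exact: gmulfV.
have tx : theta x = x^-1 by rewrite /theta lift_gen (tnth_nth 1).
have ty : theta y = y^-1 by rewrite /theta lift_gen (tnth_nth 1).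
apply: (freegroup_endo_id tM) => i /=.
have -> : gen i = tnth [tuple x; y] i.
  by rewrite (tnth_nth 1); case: i => [[|[|?]] //= ?]; congr gen; apply: val_inj.
rewrite (tnth_nth 1); case: i => [[|[|?]] //= ?].
  by rewrite tx tV tx invgK.
by rewrite ty tV ty invgK.
Qed.

(* Z_2 = <theta> is taken to be 'Z_2, its generator Zp1 standing for theta.   *)
Definition rho : F2 -> 'Z_2 := fg_lift (tnth [tuple Zp1; Zp1]).

Definition H0 : {pred F2} := [pred a | rho a == 1].

Definition circ (a b : F2) : F2 := if a \in H0 then a * b else a * theta b.

End Circ.

Section F3ByZ2.
Local Notation p := (gen (@Ordinal 3 0 isT)).
Local Notation q := (gen (@Ordinal 3 1 isT)).
Local Notation r := (gen (@Ordinal 3 2 isT)).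

(* Conjugation by s on F3 = <p, q, r>.                                        *)
Definition sigma : F3 -> F3 := fg_lift (tnth [tuple p^-1; q^-1; p * r^-1 * p^-1]).

Lemma sigmaM : {morph sigma : u v / u * v}. Proof. exact: liftM. Qed.

Lemma sigmaK : involutive sigma.
Proof.
have sM : {morph sigma \o sigma : a b / a * b}.
  by move=> b c; rewrite /= !sigmaM.
have sV u : sigma u^-1 = (sigma u)^-1 by exact: gmulfV.
have sp : sigma p = p^-1 by rewrite /sigma lift_gen (tnth_nth 1).
have sq : sigma q = q^-1 by rewrite /sigma lift_gen (tnth_nth 1).
have sr : sigma r = p * r^-1 * p^-1 by rewrite /sigma lift_gen (tnth_nth 1).
move=> u; apply: (freegroup_endo_id sM) => i /=.
have -> : gen i = tnth [tuple p; q; r] i.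
  by rewrite (tnth_nth 1); case: i => [[|[|[|?]]] //= ?]; congr gen;
    apply: val_inj.
rewrite (tnth_nth 1); case: i => [[|[|[|?]]] //= ?].
- by rewrite sp sV sp invgK.
- by rewrite sq sV sq invgK.
by rewrite sr !sigmaM !sV sp sr !invMg !invgK !mulgA mulVg mul1g mulgKV.
Qed.

Definition F3xZ2 : groupType := semidirect (invol_action sigmaM sigmaK).

(* p, q, r, s inside F3 ><| Z_2.                                              *)
Definition F3xZ2_gens : 'I_4 -> F3xZ2 :=
  tnth [tuple (p, 1); (q, 1); (r, 1); (1, Zp1)].

End F3ByZ2.

Section Relations.
Local Notation p := (gen (@Ordinal 4 0 isT)).
Local Notation q := (gen (@Ordinal 4 1 isT)).
Local Notation r := (gen (@Ordinal 4 2 isT)).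
Local Notation s := (gen (@Ordinal 4 3 isT)).

Definition pqrs_rels : seq (F4 * F4) :=
  [:: (s ^+ 2, 1);
      (s * p * s, p^-1);
      (s * q * s, q^-1);
      (s * r * s, p * r^-1 * p^-1)].

End Relations.

(* Main.v *)
(* Writing a o b = a lambda_a(b) with lambda_a = theta^(rho a), both the      *)
(* group axioms for o and the brace identity follow from theta being an       *)
(* involutive automorphism with rho (theta a) = rho a.  The two products      *)
(* agree when the left factor is in H0, and x o x = 1.  The Schreier          *)
(* transversal {1, x} shows that H0 is free on p = x^2, q = xy, r = yx, and   *)
(* conjugation by x in (F2, o) sends h in H0 to x theta(h) x^-1, which is the *)
(* automorphism sigma of F3.  Hence (k, e) |-> k x^e is an isomorphism from   *)
(* F3 ><| Z_2 onto (F2, o).                                                   *)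
Require Import Defs.
From mathcomp Require Import all_boot all_fingroup zmodp.

Set Implicit Arguments.
Unset Strict Implicit.
Unset Printing Implicit Defensive.

Local Open Scope group_scope.

(** The brace axioms reduce to a o b = a lambda_a(b), where a |-> lambda_a is a homomorphism from F2
    to the powers of theta that is invariant under theta ([rho_theta], [circ_skew_left_brace]).

    For the group (F2, o), the map (k, e) |-> k x^e from F3 ><| Z_2 is a homomorphism because x o x
    = 1 and o-conjugation by x acts on H0 as [sigma] ([conj_theta_H0_basis], [of_F3xZ2M]). It is
    onto because its image contains 1 and is stable under right multiplication by F2
    ([of_F3xZ2_onto]). It is injective because an embedding of F2 into a wreath product recovers k
    ([schreier_H0_basis], [of_F3xZ2_inj]).

    Modulo the four relations every word is congruent to a normal form k s^e ([word_cong_normal]),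
    which presents F3 ><| Z_2; the presentation is then carried along the isomorphism. *)

Lemma Z2_cases (e : 'Z_2) : e = 1 \/ e = Zp1.
Proof.
by case: e => [[|[|?]] //= ?]; [left | right]; apply: val_inj.
Qed.

Lemma freegroup_ind (I : choiceType) (P : freegroup I -> Prop) :
  P 1 -> (forall i, P (gen i)) -> (forall u v, P u -> P v -> P (u * v)) ->
  (forall u, P u -> P u^-1) -> forall u, P u.
Proof.
move=> P1 Pg PM PV u.
have -> : u = fg_lift (@gen I) u.
  by rewrite -(lift_unique (h := id)).
rewrite /fg_lift; elim: (word u) => [|[i b] s IH]; first by rewrite big_nil.
rewrite big_cons; apply: PM IH; rewrite /lift_letter /=.
by case: b; [apply: PV|]; apply: Pg.
Qed.

Lemma morph_one (G H : groupType) (h : G -> H) :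
  {morph h : u v / u * v} -> h 1 = 1.
Proof. by move=> hM; apply: (mulgI (h 1)); rewrite -hM !mulg1. Qed.

Lemma morph_eq_gen (I : choiceType) (G : groupType) (h k : freegroup I -> G) :
  {morph h : u v / u * v} -> {morph k : u v / u * v} ->
  (forall i, h (gen i) = k (gen i)) -> h =1 k.
Proof.
move=> hM kM hk u; rewrite (lift_unique hM hk).
by symmetry; apply: lift_unique.
Qed.

(** * Congruence modulo a set of relators *)

Section Congruence.
Variables (G : groupType) (R : G -> Prop).

(** Equality in the quotient by the normal closure, expressed without forming the quotient group. *)
Definition cong_mod (u v : G) : Prop := normal_closure R (u * v^-1).
Local Notation "u =~ v" := (cong_mod u v) (at level 70, no associativity).

Lemma cong_refl u : u =~ u.
Proof. by rewrite /cong_mod mulgV; apply: NC_1. Qed.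

Lemma cong_sym u v : u =~ v -> v =~ u.
Proof. by move=> /NC_V; rewrite invMg invgK. Qed.

Lemma cong_trans v u w : u =~ v -> v =~ w -> u =~ w.
Proof. by move=> uv /(NC_M uv); rewrite mulgA mulgKV. Qed.

Lemma cong_mull w u v : u =~ v -> w * u =~ w * v.
Proof. by move=> /(NC_J w^-1); rewrite /cong_mod conjgE invgK invMg !mulgA. Qed.

Lemma cong_mulr w u v : u =~ v -> u * w =~ v * w.
Proof. by rewrite /cong_mod invMg mulgA mulgK. Qed.

Lemma cong_mul u v u' v' : u =~ v -> u' =~ v' -> u * u' =~ v * v'.
Proof.
by move=> uv u'v'; apply: cong_trans (cong_mulr _ uv) (cong_mull _ u'v').
Qed.

End Congruence.

Lemma cong_rel (I : choiceType) (rels : seq (freegroup I * freegroup I)) u v :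
  (u, v) \in rels -> cong_mod (relator_of rels) u v.
Proof. by move=> uv; apply: NC_in; exists (u, v). Qed.

(** * Presentations and isomorphisms *)

Section Transport.
Variables (G H : groupType) (I : choiceType) (f : G -> H) (g : I -> G).
Hypotheses (fM : {morph f : x y / x * y}) (f_bij : bijective f).

Lemma presentation_on_iso rels :
  presentation_on g rels -> presentation_on (f \o g) rels.
Proof.
move=> [g_onto g_ker].
have fL : forall w, fg_lift (f \o g) w = f (fg_lift g w).
  move=> w; symmetry; apply: (lift_unique (h := f \o fg_lift g)) => [u v|i] /=.
    by rewrite liftM fM.
  by rewrite lift_gen.
have [f' fK f'K] := f_bij; split=> [x|w].
  by have [w gw] := g_onto (f' x); exists w; rewrite fL gw f'K.
rewrite fL -(morph_one fM).
by split=> [/(can_inj fK)/g_ker|/g_ker ->].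
Qed.

End Transport.

Lemma iso_sym (G H : groupType) :
  isomorphic_groups G H -> isomorphic_groups H G.
Proof.
move=> [f fM [f' fK f'K]]; exists f'; last by exists f.
by move=> x y; apply: (can_inj fK); rewrite fM !f'K.
Qed.

(** * The presentation of F3 ><| Z_2 *)

Lemma F3xZ2_mull (k l : F3) : ((k, 1) : F3xZ2) * (l, 1) = (k * l, 1).
Proof. by congr (_, _); apply: val_inj. Qed.

Lemma F3xZ2_invl (k : F3) : ((k, 1) : F3xZ2)^-1 = (k^-1, 1).
Proof. by congr (_, _); apply: val_inj. Qed.

Lemma F3xZ2_sJ (k : F3) :
  ((1, Zp1) : F3xZ2) * (k, 1) * (1, Zp1) = (sigma k, 1).
Proof.
congr (_, _); last exact: val_inj.
by rewrite [X in _ * X]aactg1 mulg1 [LHS]mul1g.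
Qed.

Section PresentationF3xZ2.
Local Notation p := (gen (@Ordinal 4 0 isT)).
Local Notation q := (gen (@Ordinal 4 1 isT)).
Local Notation r := (gen (@Ordinal 4 2 isT)).
Local Notation s := (gen (@Ordinal 4 3 isT)).
Local Notation L := (fg_lift F3xZ2_gens).
Local Notation "u =~ v" := (cong_mod (relator_of pqrs_rels) u v)
  (at level 70, no associativity).

Definition pqr_word : F3 -> F4 := fg_lift (tnth [tuple p; q; r]).

Definition normal_word (z : F3xZ2) : F4 := pqr_word z.1 * s ^+ z.2.

Lemma pqr_wordM : {morph pqr_word : u v / u * v}.
Proof. exact: liftM. Qed.

Lemma lift_pqr_word k : L (pqr_word k) = (k, 1).
Proof.
apply: (morph_eq_gen (h := L \o pqr_word) (k := fun k => (k, 1) : F3xZ2))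
  => [u v|u v|i].
- by rewrite /= pqr_wordM liftM.
- by congr (_, _); rewrite mulg1.
rewrite /= /pqr_word lift_gen (tnth_nth 1).
case: i => [[|[|[|?]]] //= lti]; rewrite lift_gen /F3xZ2_gens (tnth_nth 1) /=;
  by congr (gen _, _); apply: val_inj.
Qed.

Lemma lift_normal_word : cancel normal_word L.
Proof.
move=> [k e]; rewrite /normal_word liftM lift_pqr_word /=.
have Ls : L s = (1, Zp1) by rewrite lift_gen /F3xZ2_gens (tnth_nth 1).
have [->|->] := Z2_cases e; first by rewrite expg0 lift1 mulg1.
by rewrite expg1 Ls; congr (_, _); rewrite ?mulg1 ?mul1g.
Qed.

(** On generators this is one of the last three relations, rewritten with s^2 = 1; it then extends
    to products and inverses. It is the rule that moves s to the right in a word. *)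
Lemma s_pqr_word k : s * pqr_word k =~ pqr_word (sigma k) * s.
Proof.
have ss : s * s =~ 1 by apply: cong_rel; rewrite inE eqxx.
have step u v : s * u * s =~ v -> s * u =~ v * s.
  move=> suv; apply: cong_trans (cong_mulr s suv).
  apply: cong_sym; rewrite -[X in _ =~ X]mulg1 -mulgA; exact: cong_mull.
have pv i : pqr_word (gen i) = tnth [tuple p; q; r] i.
  by rewrite /pqr_word lift_gen.
have pV u : pqr_word u^-1 = (pqr_word u)^-1 by exact: gmulfV.
have sV u : sigma u^-1 = (sigma u)^-1 by exact: gmulfV.
elim/freegroup_ind: k => [|i|u v IHu IHv|u IH].
- rewrite /sigma /pqr_word !lift1 mulg1 mul1g. exact: cong_refl.
- apply: step; rewrite pv /sigma lift_gen !(tnth_nth 1).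
  by case: i => [[|[|[|?]]] //= _]; rewrite ?pqr_wordM ?pV !pv !(tnth_nth 1) /=;
    apply: cong_rel; rewrite !inE eqxx ?orbT.
- rewrite sigmaM !pqr_wordM mulgA.
  apply: cong_trans (cong_mulr _ IHu) _.
  by rewrite -!mulgA; apply: cong_mull.
rewrite sV !pV; set a := pqr_word u in IH *; set b := pqr_word _ in IH *.
(* From s a =~ b s, multiplying by b^-1 on the left and a^-1 on the right gives b^-1 s =~ s a^-1. *)
have := cong_mull b^-1 (cong_mulr a^-1 IH).
by rewrite -(mulgA b) !mulgA mulVg mul1g mulgK => /cong_sym.
Qed.

Lemma normal_wordM z z' :
  normal_word (z * z') =~ normal_word z * normal_word z'.
Proof.
have ss : s * s =~ 1 by apply: cong_rel; rewrite inE eqxx.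
case: z z' => [k e] [k' e'].
have -> : normal_word (((k, e) : F3xZ2) * (k', e')) =
    pqr_word k * (pqr_word (invol_act sigma e k') * s ^+ (e * e')%g).
  by rewrite /normal_word pqr_wordM mulgA.
rewrite {1}/normal_word -mulgA; apply: cong_mull.
rewrite /normal_word /invol_act -[(k', e').1]/k' -[(k', e').2]/e' -[(k, e).2]/e.
have [->|->] := Z2_cases e.
  by rewrite eqxx expg0 !mul1g; apply: cong_refl.
rewrite expg1 [_ == 1]/= mulgA.
apply: cong_trans (cong_mulr _ (cong_sym (s_pqr_word k'))).
rewrite -mulgA; apply: cong_mull.
have [->|->] := Z2_cases e'.
  by rewrite mulg1 expg0 mulg1; apply: cong_refl.
by apply: cong_sym.
Qed.

(** Both sides are multiplicative in w up to congruence, so generators suffice. When L w = 1 the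
    right side is 1, so the kernel of L lies in the normal closure. *)
Lemma word_cong_normal w : w =~ normal_word (L w).
Proof.
have n1 : normal_word 1 = 1 by rewrite /normal_word /pqr_word lift1 mul1g.
elim/freegroup_ind: w => [|i|u v IHu IHv|u IH].
- by rewrite lift1 n1; apply: cong_refl.
- rewrite lift_gen /F3xZ2_gens (tnth_nth 1) /normal_word.
  have -> : gen i = tnth [tuple p; q; r; s] i.
    rewrite (tnth_nth 1).
    by case: i => [[|[|[|[|?]]]] //= ?]; congr gen; apply: val_inj.
  rewrite (tnth_nth 1).
  case: i => [[|[|[|[|?]]]] //= _]; rewrite ?mulg1 /pqr_word ?lift_gen
    ?(tnth_nth 1) ?lift1 ?mul1g ?expg0 ?mulg1; exact: cong_refl.
- rewrite liftM; apply: cong_trans (cong_mul IHu IHv) _.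
  exact: cong_sym (normal_wordM _ _).
have LV : L u^-1 = (L u)^-1 by exact: gmulfV.
have := cong_mul (cong_refl _ (normal_word (L u^-1))) (cong_sym IH).
move/(cong_trans (normal_wordM _ _)); rewrite LV mulVg n1.
by move/(cong_mulr u^-1); rewrite mul1g mulgK.
Qed.

Lemma presentation_F3xZ2 : presentation_on F3xZ2_gens pqrs_rels.
Proof.
split=> [z|w]; first by exists (normal_word z); apply: lift_normal_word.
split=> [Lw|].
  have := word_cong_normal w.
  by rewrite Lw /normal_word /pqr_word lift1 mul1g /cong_mod invg1 mulg1.
have LV u : L u^-1 = (L u)^-1 by exact: gmulfV.
elim=> [_ [uv uvR ->]||u v _ Lu _ Lv|u _ Lu|u v _ Lu].
- have Lg i : L (gen i) = F3xZ2_gens i by exact: lift_gen.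
  suff E : L uv.1 = L uv.2 by rewrite liftM LV E mulgV.
  move: uvR; rewrite !inE => /or4P[]/eqP-> /=;
    rewrite ?expgS ?expg0 ?mulg1 !liftM ?LV !Lg ?lift1 /F3xZ2_gens
      !(tnth_nth 1) /=.
  - by congr (_, _); [rewrite !mul1g [LHS]lift1 | apply: val_inj].
  - by rewrite F3xZ2_sJ /sigma lift_gen (tnth_nth 1) F3xZ2_invl.
  - by rewrite F3xZ2_sJ /sigma lift_gen (tnth_nth 1) F3xZ2_invl.
  by rewrite F3xZ2_sJ /sigma lift_gen (tnth_nth 1) !F3xZ2_invl !F3xZ2_mull.
- exact: lift1.
- by rewrite liftM Lu Lv mulg1.
- by rewrite LV Lu invg1.
by rewrite conjgE !liftM Lu mul1g LV mulVg.
Qed.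

End PresentationF3xZ2.

(** * The skew left brace *)

Section Brace.

(** Theta inverts the generators, and every element of Z_2 is its own inverse. *)
Lemma rho_theta a : rho (theta a) = rho a.
Proof.
apply: (morph_eq_gen (h := rho \o theta)) => [u v|u v|i].
- by rewrite /= /theta liftM /rho liftM.
- exact: liftM.
have rV u : rho u^-1 = (rho u)^-1 by exact: gmulfV.
rewrite /= /theta lift_gen (tnth_nth 1).
by case: i => [[|[|?]] //= ?]; rewrite rV /rho !lift_gen !(tnth_nth 1) /=;
  apply: val_inj.
Qed.

Definition lambda (e : 'Z_2) : F2 -> F2 := if e == 1 then id else theta.

Lemma circE a b : circ a b = a * lambda (rho a) b.
Proof. by rewrite /circ /lambda inE; case: ifP. Qed.

Lemma lambdaM e : {morph lambda e : a b / a * b}.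
Proof. by rewrite /lambda; case: ifP => _ a b //; apply: liftM. Qed.

Lemma lambdaD d e a : lambda d (lambda e a) = lambda (d * e) a.
Proof.
have tK := theta_aut.2.
by case: (Z2_cases d) (Z2_cases e) => -> [] ->; rewrite /lambda /= ?tK.
Qed.

Lemma rho_lambda e a : rho (lambda e a) = rho a.
Proof. by rewrite /lambda; case: ifP => // _; apply: rho_theta. Qed.

Definition circ_invg (a : F2) : F2 := lambda (rho a) a^-1.

Lemma circ_skew_left_brace : skew_left_brace circ.
Proof.
have rM u v : rho (u * v) = rho u * rho v by exact: liftM.
have rV u : rho u^-1 = (rho u)^-1 by exact: gmulfV.
have l1 e : lambda e 1 = 1 by exact: morph_one (lambdaM e).
have l0 a : lambda 1 a = a by [].
have z2 (e : 'Z_2) : e^-1 = e.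
  by case: (Z2_cases e) => ->; apply: val_inj.
exists 1 circ_invg => [a b c|a|a|a|a|a b c].
- by rewrite !circE rM rho_lambda lambdaM lambdaD mulgA.
- by rewrite circE mul1g /rho lift1.
- by rewrite circE l1 mulg1.
- by rewrite circE /circ_invg rho_lambda rV z2 -lambdaM mulVg l1.
- by rewrite circE /circ_invg lambdaD -{2}[rho a]z2 mulgV l0 mulgV.
by rewrite !circE lambdaM !mulgA mulgKV.
Qed.

End Brace.

(** * The isomorphism from F3 ><| Z_2 onto (F2, o) *)

Section Iso.
Local Notation x := (gen (@Ordinal 2 0 isT)).
Local Notation y := (gen (@Ordinal 2 1 isT)).
Local Notation p := (gen (@Ordinal 3 0 isT)).
Local Notation q := (gen (@Ordinal 3 1 isT)).
Local Notation r := (gen (@Ordinal 3 2 isT)).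

Definition H0_basis : F3 -> F2 := fg_lift (tnth [tuple x * x; x * y; y * x]).

Lemma H0_basisM : {morph H0_basis : u v / u * v}.
Proof. exact: liftM. Qed.

Definition of_F3xZ2 (z : F3xZ2) : F2 := H0_basis z.1 * x ^+ z.2.

Lemma H0_basisE :
  (H0_basis p = x * x) * (H0_basis q = x * y) * (H0_basis r = y * x).
Proof. by rewrite /H0_basis !lift_gen !(tnth_nth 1). Qed.

Lemma H0_basisV u : H0_basis u^-1 = (H0_basis u)^-1.
Proof. exact: gmulfV. Qed.

Lemma rho_H0_basis k : rho (H0_basis k) = 1.
Proof.
apply: (morph_eq_gen (h := rho \o H0_basis) (k := fun=> 1)) => [u v|u v|i].
- by rewrite /= H0_basisM /rho liftM.
- by rewrite mulg1.
rewrite /= /H0_basis lift_gen (tnth_nth 1).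
case: i => [[|[|[|?]]] //= _]; rewrite /rho liftM !lift_gen !(tnth_nth 1);
  exact: val_inj.
Qed.

Lemma conj_theta_H0_basis k :
  x * theta (H0_basis k) * x^-1 = H0_basis (sigma k).
Proof.
apply: (morph_eq_gen (h := fun k => x * theta (H0_basis k) * x^-1)
  (k := H0_basis \o sigma)) => [u v|u v|i].
- by rewrite H0_basisM /theta liftM !mulgA mulgKV.
- by rewrite /= sigmaM H0_basisM.
have tM : {morph theta : u v / u * v} by exact: liftM.
have tx : theta x = x^-1 by rewrite /theta lift_gen (tnth_nth 1).
have ty : theta y = y^-1 by rewrite /theta lift_gen (tnth_nth 1).
rewrite /= {1}/H0_basis lift_gen /sigma lift_gen !(tnth_nth 1).
case: i => [[|[|[|?]]] //= _]; rewrite tM !(tx, ty) ?H0_basisM !H0_basisV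
  ?H0_basisE ?H0_basisM ?H0_basisV ?H0_basisE !invMg !mulgA ?mulgV ?mul1g //.
Qed.

Lemma of_F3xZ2M z z' : of_F3xZ2 (z * z') = circ (of_F3xZ2 z) (of_F3xZ2 z').
Proof.
have rM u v : rho (u * v) = rho u * rho v by exact: liftM.
have rx : rho x = Zp1 by rewrite /rho lift_gen (tnth_nth 1).
have tx : theta x = x^-1 by rewrite /theta lift_gen (tnth_nth 1).
case: z z' => [k e] [k' e'].
have -> : of_F3xZ2 (((k, e) : F3xZ2) * (k', e')) =
    H0_basis k * (H0_basis (invol_act sigma e k') * x ^+ (e * e')%g).
  by rewrite /of_F3xZ2 H0_basisM mulgA.
have ofE l d : of_F3xZ2 (l, d) = H0_basis l * x ^+ d by [].
rewrite circE !ofE rM rho_H0_basis mul1g -mulgA; congr (_ * _).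
have [->|->] := Z2_cases e.
  by rewrite /invol_act eqxx expg0 /rho lift1 /lambda eqxx !mul1g.
rewrite expg1 rx lambdaM /invol_act /lambda /= -conj_theta_H0_basis -!mulgA.
(* What remains is x^-1 x^(1 - e') = theta(x^e'), which for e' = 1 is theta(x) = x^-1. *)
do 2!congr (_ * _); have [->|->] := Z2_cases e'.
  by rewrite [x ^+ _ in LHS]expg1 mulVg /theta expg0 lift1.
by rewrite [x ^+ _ in RHS]expg1 tx [x ^+ _]expg0 mulg1.
Qed.

Lemma swapM : {morph (fun k : F3 * F3 => (k.2, k.1)) : u v / u * v}.
Proof. by []. Qed.

Lemma swapK : involutive (fun k : F3 * F3 => (k.2, k.1)).
Proof. by case. Qed.

(** The two coordinates of F3 * F3 correspond to the cosets H0 and H0 x, which odd elements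
    exchange. *)
Definition F3wrZ2 : groupType := semidirect (invol_action swapM swapK).

(* Right multiplication on F2 = H0 u H0 x: if w has image ((a, b), e), then   *)
(* w = a x^e and x w = b x^(1 - e).                                           *)
Definition schreier : F2 -> F3wrZ2 :=
  @fg_lift _ F3wrZ2 (tnth [tuple ((1, p), Zp1); ((r * p^-1, q), Zp1)]).

Lemma schreier_H0_basis k : exists k', schreier (H0_basis k) = ((k, k'), 1).
Proof.
(* Ordinary conjugation h |-> x h x^-1 on H0, read in the generators p, q, r. *)
pose conj_x : F3 -> F3 := fg_lift (tnth [tuple p; p * r * p^-1; q]).
exists (conj_x k).
have sM : {morph schreier : u v / u * v} by exact: liftM.
apply: (morph_eq_gen (h := schreier \o H0_basis)
  (k := fun k => ((k, conj_x k), 1) : F3wrZ2)) => [u v|u v|i].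
- by rewrite /= H0_basisM sM.
- rewrite /conj_x liftM; congr (_, _); exact: val_inj.
rewrite /= /conj_x /H0_basis !lift_gen !(tnth_nth 1).
have sx : schreier x = ((1, p), Zp1) by rewrite /schreier lift_gen (tnth_nth 1).
have sy : schreier y = ((r * p^-1, q), Zp1).
  by rewrite /schreier lift_gen (tnth_nth 1).
case: i => [[|[|[|?]]] //= lti]; rewrite sM ?sx ?sy;
  congr ((_, _), _); try exact: val_inj;
  rewrite [LHS]/= ?mul1g ?mulgKV; congr gen; exact: val_inj.
Qed.

(** [rho] recovers e; after cancelling x^e, the first coordinate of [schreier] recovers k. *)
Lemma of_F3xZ2_inj : injective of_F3xZ2.
Proof.
have rM u v : rho (u * v) = rho u * rho v by exact: liftM.
have rx : rho x = Zp1 by rewrite /rho lift_gen (tnth_nth 1).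
move=> [k e] [k' e'] eq_kk'.
have ee' : e = e'.
  have := congr1 rho eq_kk'; rewrite /of_F3xZ2 !rM !rho_H0_basis !mul1g /=.
  by case: (Z2_cases e) (Z2_cases e') => -> [] ->;
    rewrite ?expg1 ?expg0 ?rx /rho ?lift1.
move: eq_kk'; rewrite -ee' => /mulIg /= /(congr1 schreier).
have [l ->] := schreier_H0_basis k; have [l' ->] := schreier_H0_basis k'.
by case=> ->.
Qed.

Lemma of_F3xZ2_onto w : exists z, w = of_F3xZ2 z.
Proof.
(* Carrying w and w^-1 together makes the inverse case of the induction immediate. *)
pose stable u := forall z : F3xZ2, exists z', of_F3xZ2 z * u = of_F3xZ2 z'.
suff [stable_w _] : stable w /\ stable w^-1.
  have [z' Ez'] := stable_w 1; exists z'.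
  by rewrite -Ez' /of_F3xZ2 /= /H0_basis lift1 !mul1g.
elim/freegroup_ind: w => [|i|u v [IHu IHuV] [IHv IHvV]|u [IH IHV]].
- by rewrite invg1; split=> z; exists z; rewrite mulg1.
- have of0 k : of_F3xZ2 (k, 1) = H0_basis k by exact: mulg1.
  have of1 k : of_F3xZ2 (k, Zp1) = H0_basis k * x by [].
  have -> : gen i = tnth [tuple x; y] i.
    rewrite (tnth_nth 1).
    by case: i => [[|[|?]] //= ?]; congr gen; apply: val_inj.
  rewrite (tnth_nth 1).
  (* Coset table for x, x^-1, y, y^-1: for instance x^-1 = p^-1 x, y = r p^-1 x, y^-1 = q^-1 x and x
     y^-1 = p r^-1. *)
  case: i => [[|[|?]] //= _]; split=> -[k e]; have [->|->] := Z2_cases e;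
    [exists (k, Zp1) | exists (k * p, 1)
    |exists (k * p^-1, Zp1) | exists (k, 1)
    |exists (k * r * p^-1, Zp1) | exists (k * q, 1)
    |exists (k * q^-1, Zp1) | exists (k * p * r^-1, 1)];
    by rewrite ?of0 ?of1 ?H0_basisM ?H0_basisV ?H0_basisE ?invMg ?mulgA
      ?mulgKV ?mulgK.
- split=> z.
    have [z1 uz] := IHu z; have [z2 vz] := IHv z1.
    by exists z2; rewrite mulgA uz.
  have [z1 vz] := IHvV z; have [z2 uz] := IHuV z1.
  by exists z2; rewrite invMg mulgA vz.
by rewrite invgK.
Qed.

End Iso.

Theorem proposition3p11 :
  exists B : skew_left_brace circ,
    [/\ presented_by (circ_group B) pqrs_rels,
        isomorphic_groups (circ_group B) F3xZ2
      & presentation_on F3xZ2_gens pqrs_rels].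
Proof.
have of_F3xZ2_bij : bijective of_F3xZ2.
  (* Stating surjectivity with decidable equality lets [xchoose] produce an inverse function. *)
  have onto w : exists z : F3xZ2, w == of_F3xZ2 z.
    by have [z ->] := of_F3xZ2_onto w; exists z.
  have ofK w : of_F3xZ2 (xchoose (onto w)) = w.
    exact/esym/eqP/(xchooseP (onto w)).
  by exists (fun w => xchoose (onto w)) => // z; apply: of_F3xZ2_inj.
exists circ_skew_left_brace.
pose f : F3xZ2 -> circ_group circ_skew_left_brace := of_F3xZ2.
have fM : {morph f : z z' / z * z'} by exact: of_F3xZ2M.
split; last exact: presentation_F3xZ2.
  exists (f \o F3xZ2_gens).
  exact: presentation_on_iso presentation_F3xZ2.
by apply: iso_sym; exists f.
Qed.
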